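(* Let $\varphi:\mathbf{R}^2\to\mathbf{R}^2$ be a linear operator with two real eigenvalues $\lambda_1,\lambda_2$ satisfying $0<\lambda_1<\lambda_2$. Let $L_1,L_2$ be the one-dimensional eigenspaces for $\lambda_1,\lambda_2$ respectively, and let $\beta\in(0,\pi/2]$ be the angle between the lines $L_1$ and $L_2$. For every nonzero vector $\mathbf{x}\in\mathbf{R}^2$, let $\gamma\in[0,\pi]$ be the angle between $\mathbf{x}$ and $\varphi(\mathbf{x})$. Then $$0\leqslant\gamma\leqslant\arccos\frac{2\sqrt{\lambda_1\lambda_2}-(\lambda_1+\lambda_2)\cos\beta}{\lambda_1+\lambda_2-2\sqrt{\lambda_1\lambda_2}\cos\beta}.$$
   Context: $\mathbf{R}^2$ is the standard Euclidean plane with the standard inner product $(\cdot,\cdot)$. The angle between two nonzero vectors $\mathbf{x},\mathbf{y}$ is the unoriented angle $\arccos\frac{(\mathbf{x},\mathbf{y})}{|\mathbf{x}|\,|\mathbf{y}|}\in[0,\pi]$. *)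

(* Defs.v *)
From HB Require Import structures.
From mathcomp Require Import all_boot all_order all_algebra.
From mathcomp Require Import reals trigo.
From mathcomp Require Import ring.

Set Implicit Arguments.
Unset Strict Implicit.
Unset Printing Implicit Defensive.

Import Order.TTheory GRing.Theory Num.Theory.
Local Open Scope ring_scope.

Section EuclideanPlane.
Variable R : realType.
Implicit Types (u v x y : 'rV[R]_2) (L M : {vspace 'rV[R]_2}).

Definition dotp x y : R := \sum_(i < 2) x 0 i * y 0 i.

(* The norm `|x| that MathComp-Analysis puts on row vectors is the sup norm,
   hence a separate Euclidean norm. *)
Definition enorm x : R := Num.sqrt (dotp x x).

Definition vangle x y : R := acos (dotp x y / (enorm x * enorm y)).

(* Two lines form two supplementary angles; the angle between them is the
   smaller one.  [vpick L] is a nonzero vector of L when L != 0; the lemma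
   [line_angle_dirE] shows that any other direction vectors give the same
   value. *)
Definition line_angle L M : R :=
  Num.min (vangle (vpick L) (vpick M)) (vangle (vpick L) (- vpick M)).

Lemma dotpZ (a b : R) x y : dotp (a *: x) (b *: y) = a * b * dotp x y.
Proof. by rewrite /dotp mulr_sumr; apply: eq_bigr => i _; rewrite !mxE; ring. Qed.

Lemma enormZ (a : R) x : enorm (a *: x) = `|a| * enorm x.
Proof. by rewrite /enorm dotpZ -expr2 sqrtrM ?sqr_ge0 // sqrtr_sqr. Qed.

Lemma vangleZ (a b : R) x y : 0 < a * b -> vangle (a *: x) (b *: y) = vangle x y.
Proof.
move=> ab0; rewrite /vangle dotpZ !enormZ; congr acos.
by rewrite mulrACA -normrM gtr0_norm // -mulf_div divff ?gt_eqF // mul1r.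
Qed.

Lemma line_angle_dirE L M u v : (\dim L = 1)%N -> (\dim M = 1)%N ->
  u \in L -> u != 0 -> v \in M -> v != 0 ->
  line_angle L M = Num.min (vangle u v) (vangle u (- v)).
Proof.
have dir (N : {vspace 'rV[R]_2}) w : (\dim N = 1)%N -> w \in N -> w != 0 ->
    exists2 a : R, a != 0 & vpick N = a *: w.
  move=> dN wN w0; have /eqP defN : (<[w]> == N)%VS.
    by rewrite eqEdim dim_vline w0 dN -memvE wN.
  have /vlineP[a Ea] : vpick N \in <[w]>%VS by rewrite defN memv_pick.
  exists a => //; apply/eqP => a0.
  have : vpick N == 0 by rewrite Ea a0 scale0r.
  by rewrite vpick0 -dimv_eq0 dN.
move=> dL dM uL u0 vM v0; rewrite /line_angle.
have [a a0 ->] := dir _ _ dL uL u0; have [b b0 ->] := dir _ _ dM vM v0.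
have : a * b != 0 by rewrite mulf_neq0.
rewrite neq_lt => /orP[ab0|ab0]; last first.
  by rewrite -scalerN !vangleZ.
have abN0 : 0 < a * - b by rewrite mulrN oppr_gt0.
have -> : b *: v = (- b) *: (- v) by rewrite scalerN scaleNr opprK.
by rewrite minC -scalerN opprK !vangleZ.
Qed.

End EuclideanPlane.

(* Main.v *)
Require Import Defs.
From mathcomp Require Import all_boot all_order all_algebra.
From mathcomp Require Import reals trigo.
From mathcomp Require Import ring lra.
Import Order.TTheory GRing.Theory Num.Theory.
Local Open Scope ring_scope.

(** Choose unit eigenvectors [u] and [v] for [lambda1] and [lambda2], write
    [s] for their inner product, so that [cos beta = `|s|], and decompose
    [x = a u + b v].  With [P] the inner product of [x] and [phi x] and [D]
    their cross product, the claim compares the cotangent [P / `|D|] of the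
    angle with a fixed number, and both are explicit:
      [P = lambda1 a^2 + lambda2 b^2 + (lambda1 + lambda2) s a b],
      [D = a b (lambda2 - lambda1) (u x v)], with [(u x v)^2 = 1 - s^2].
    By the arithmetic-geometric mean inequality the first two terms of [P] are
    at least [2 sqrt (lambda1 lambda2) `|a b|], and the third is at least
    [- (lambda1 + lambda2) `|s| `|a b|]; hence [P >= `|a b| Q], where
    [Q = 2 sqrt (lambda1 lambda2) - (lambda1 + lambda2) cos beta] is the
    numerator of the claimed bound.  Its denominator
    [T = lambda1 + lambda2 - 2 sqrt (lambda1 lambda2) cos beta] satisfies
    [T^2 - Q^2 = (lambda2 - lambda1)^2 (1 - s^2)], that is,
    [D^2 = (a b)^2 (T^2 - Q^2)]: the angle [acos (Q / T)] has cotangent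
    [Q / sqrt (T^2 - Q^2)], which is at most [P / `|D|].  Lemma [cot_le_cos]
    turns this comparison of cotangents into one of cosines, whatever the
    signs of [P] and [Q]; it is stated without division, so that it covers
    [D = 0] as well, the case of an eigenvector [x].  Finally [acos] is
    decreasing on [[-1, 1]]. *)

Section Angles.
Set Implicit Arguments.
Unset Strict Implicit.
Variable R : realType.
Implicit Types (u v x y : 'rV[R]_2) (L M : {vspace 'rV[R]_2}).

(** * Inner and cross products in the plane *)

Definition cross x y : R := x 0 0 * y 0 1 - x 0 1 * y 0 0.

Lemma dotpE x y : dotp x y = x 0 0 * y 0 0 + x 0 1 * y 0 1.
Proof.
rewrite /dotp big_ord_recl big_ord1.
by have -> : lift ord0 ord0 = 1 :> 'I_2 by apply: val_inj.
Qed.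

Lemma rV2_eqP x y : x 0 0 = y 0 0 -> x 0 1 = y 0 1 -> x = y.
Proof.
move=> e0 e1; apply/rowP => i; case: (unliftP 0 i) => [j|] -> //.
by have -> : lift 0 j = 1 :> 'I_2 by rewrite (ord1 j); apply: val_inj.
Qed.

Lemma dotpNr x y : dotp x (- y) = - dotp x y.
Proof. by rewrite !dotpE !mxE; ring. Qed.

Lemma enormN x : enorm (- x) = enorm x.
Proof. by rewrite -scaleN1r enormZ normrN1 mul1r. Qed.

Lemma enorm_ge0 x : 0 <= enorm x.
Proof. exact: sqrtr_ge0. Qed.

Lemma sqr_enorm x : enorm x ^+ 2 = dotp x x.
Proof. by rewrite sqr_sqrtr // dotpE; nra. Qed.

Lemma enorm_gt0 x : x != 0 -> 0 < enorm x.
Proof.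
move=> x0; rewrite lt0r enorm_ge0 andbT; apply: contraNneq x0 => n0.
have := sqr_enorm x; rewrite n0 dotpE => h.
by apply/eqP/rV2_eqP; rewrite !mxE; nra.
Qed.

Lemma lagrange_identity x y :
  (enorm x * enorm y) ^+ 2 = dotp x y ^+ 2 + cross x y ^+ 2.
Proof. by rewrite exprMn !sqr_enorm !dotpE /cross; ring. Qed.

Lemma cross_decomp u v x : cross u v != 0 ->
  x = (cross x v / cross u v) *: u + (cross u x / cross u v) *: v.
Proof.
by rewrite /cross => uv0; apply: rV2_eqP; rewrite !mxE; field.
Qed.

(** * Cosines of angles *)

Lemma cos_vangle_bound x y : x != 0 -> y != 0 ->
  -1 <= dotp x y / (enorm x * enorm y) <= 1.
Proof.
move=> x0 y0; have n0 : 0 < enorm x * enorm y by rewrite mulr_gt0 ?enorm_gt0.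
rewrite -ler_norml normrM normfV (gtr0_norm n0) ler_pdivrMr // mul1r.
rewrite -(@ler_pXn2r _ 2) ?nnegrE ?(ltW n0) // real_normK ?num_real //.
by rewrite lagrange_identity lerDl sqr_ge0.
Qed.

Lemma le_acos (x y : R) : -1 <= x -> x <= y -> y <= 1 -> acos y <= acos x.
Proof.
move=> x1 xy y1; have hx : -1 <= x <= 1 by rewrite x1 (le_trans xy).
have hy : -1 <= y <= 1 by rewrite y1 andbT (le_trans x1).
rewrite leNgt; apply/negP => lt_acos.
have := lt_acos; rewrite -ltr_cos ?in_itv/= ?acos_ge0 ?acos_lepi //.
by rewrite !acosK ?in_itv //= ltNge xy.
Qed.

Lemma vpick_neq0 L : L != 0%VS -> vpick L != 0.
Proof. by rewrite vpick0. Qed.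

(** The smaller of two supplementary angles has the nonnegative cosine. *)
Lemma cos_line_angle L M : L != 0%VS -> M != 0%VS ->
  cos (line_angle L M) =
    `|dotp (vpick L) (vpick M) / (enorm (vpick L) * enorm (vpick M))|.
Proof.
move=> /vpick_neq0 L0 /vpick_neq0 M0.
rewrite /line_angle /vangle dotpNr enormN mulNr.
have := cos_vangle_bound L0 M0; set k := _ / _ => /andP[k1 k2].
have [k0|k0] := leP 0 k.
  rewrite min_l; last by rewrite le_acos //; lra.
  by rewrite acosK ?ger0_norm // in_itv /= k1.
rewrite min_r; last by rewrite le_acos //; lra.
by rewrite acosK ?ltr0_norm // in_itv /=; lra.
Qed.

(** * The extremal inequality *)

(** If [N] is the hypotenuse over [P] and [D], where [D = t sqrt (T^2 - Q^2)],
    then comparing the cotangents [P / D] and [Q / sqrt (T^2 - Q^2)] amounts to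
    comparing the cosines [P / N] and [Q / T]. *)
Lemma cot_le_cos (P N Q T t : R) : 0 <= N -> 0 <= T -> 0 <= t ->
  Q ^+ 2 <= T ^+ 2 -> N ^+ 2 = P ^+ 2 + t ^+ 2 * (T ^+ 2 - Q ^+ 2) ->
  t * Q <= P -> Q * N <= P * T.
Proof.
move=> N0 T0 t0 QT NE tQP.
(* Squaring reduces the goal to comparing [P] with [t Q] in absolute value:
   [P] is the larger one when both are nonnegative, and the smaller one, as
   needed after the change of signs, when both are negative. *)
have key : (P * T) ^+ 2 - (Q * N) ^+ 2
         = (T ^+ 2 - Q ^+ 2) * (P ^+ 2 - (t * Q) ^+ 2).
  by rewrite !exprMn NE; ring.
have d0 : 0 <= T ^+ 2 - Q ^+ 2 by rewrite subr_ge0.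
have [Q0|Q0] := leP 0 Q.
  have tQ0 : 0 <= t * Q by rewrite mulr_ge0.
  have P0 := le_trans tQ0 tQP.
  rewrite -(@ler_pXn2r _ 2) ?nnegrE ?mulr_ge0 // -subr_ge0 key.
  by rewrite mulr_ge0 // subr_ge0 ler_pXn2r ?nnegrE.
have [P0|P0] := leP 0 P.
  by apply: (@le_trans _ _ 0); [rewrite nmulr_rle0 | rewrite mulr_ge0].
have nP : 0 <= - P by lra.
have nQ : 0 <= - Q by lra.
have h : - P <= t * - Q by lra.
rewrite -lerN2 -!mulNr -(@ler_pXn2r _ 2) ?nnegrE ?mulr_ge0 //.
rewrite !mulNr !sqrrN -subr_le0 key mulr_ge0_le0 // subr_le0.
rewrite -[P ^+ 2]sqrrN -[(t * Q) ^+ 2]sqrrN -mulrN.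
by rewrite ler_pXn2r ?nnegrE ?mulr_ge0.
Qed.

Section ExtremalAngle.
Variables (l1 l2 c : R).
Hypotheses (l1_gt0 : 0 < l1) (l12 : l1 < l2) (c0 : 0 <= c) (c1 : c <= 1).

Let Q := 2 * Num.sqrt (l1 * l2) - (l1 + l2) * c.
Let T := l1 + l2 - 2 * Num.sqrt (l1 * l2) * c.

Let l2_gt0 : 0 < l2. Proof. exact: lt_trans l12. Qed.

Let sqr_gmean : Num.sqrt (l1 * l2) ^+ 2 = l1 * l2.
Proof. by rewrite sqr_sqrtr // mulr_ge0 // ltW. Qed.

Lemma extremal_den_gt0 : 0 < T.
Proof.
have g0 : 0 <= Num.sqrt (l1 * l2) := sqrtr_ge0 _.
have agm : 2 * Num.sqrt (l1 * l2) < l1 + l2.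
  rewrite -(@ltr_pXn2r _ 2) ?nnegrE ?mulr_ge0 //;
    last by rewrite addr_ge0 // ltW.
  rewrite exprMn sqr_gmean.
  have : 0 < (l2 - l1) ^+ 2 by rewrite exprn_gt0 // subr_gt0.
  by lra.
rewrite /T subr_gt0; apply: le_lt_trans agm.
by rewrite ler_piMr // mulr_ge0.
Qed.

(** The map taking [(S, G)] to [(S - c G, G - c S)] multiplies the quadratic
    form [S^2 - G^2] by [1 - c^2]; at [S = l1 + l2], [G = 2 sqrt (l1 l2)] that
    form is [(l2 - l1)^2]. *)
Lemma extremal_sqrB : T ^+ 2 - Q ^+ 2 = (l2 - l1) ^+ 2 * (1 - c ^+ 2).
Proof.
transitivity (((l1 + l2) ^+ 2 - 4 * Num.sqrt (l1 * l2) ^+ 2) * (1 - c ^+ 2)).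
  by rewrite /T /Q; ring.
by rewrite sqr_gmean; ring.
Qed.

Lemma extremal_sqr_le : Q ^+ 2 <= T ^+ 2.
Proof.
rewrite -subr_ge0 extremal_sqrB mulr_ge0 ?sqr_ge0 // subr_ge0.
by rewrite expr_le1.
Qed.

Lemma extremal_dotp (s a b : R) : `|s| = c ->
  `|a * b| * Q <= l1 * a ^+ 2 + l2 * b ^+ 2 + (l1 + l2) * s * (a * b).
Proof.
move=> sc; have g0 : 0 <= Num.sqrt (l1 * l2) := sqrtr_ge0 _.
have agm : 2 * Num.sqrt (l1 * l2) * `|a * b| <= l1 * a ^+ 2 + l2 * b ^+ 2.
  have sl1 : Num.sqrt l1 ^+ 2 = l1 by rewrite sqr_sqrtr // ltW.
  have sl2 : Num.sqrt l2 ^+ 2 = l2 by rewrite sqr_sqrtr // ltW.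
  have := sqr_ge0 (Num.sqrt l1 * `|a| - Num.sqrt l2 * `|b|).
  rewrite sqrrB !exprMn sl1 sl2 !real_normK ?num_real //.
  rewrite sqrtrM ?(ltW l1_gt0) // normrM; lra.
have cross_term : - (c * `|a * b|) <= s * (a * b).
  by rewrite -sc -normrM lerNl -normrN ler_norm.
have : (l1 + l2) * - (c * `|a * b|) <= (l1 + l2) * (s * (a * b)).
  by rewrite ler_wpM2l // addr_ge0 // ltW.
by rewrite /Q; lra.
Qed.

(** The scalar form of the theorem: [P] is the inner product, and [N] the
    product of the norms, of [a u + b v] and [l1 a u + l2 b v], for unit
    vectors [u], [v] whose inner product is [s]. *)
Lemma extremal_cos (s a b P N : R) : `|s| = c -> 0 < N ->
  P = l1 * a ^+ 2 + l2 * b ^+ 2 + (l1 + l2) * s * (a * b) ->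
  N ^+ 2 = P ^+ 2 + (a * b * (l2 - l1)) ^+ 2 * (1 - s ^+ 2) ->
  Q / T <= P / N.
Proof.
move=> sc N0 PE NE; have T0 := extremal_den_gt0.
rewrite ler_pdivrMr // mulrAC ler_pdivlMr //.
apply: (@cot_le_cos _ _ _ _ `|a * b|); rewrite ?(ltW N0) ?(ltW T0) //.
- exact: extremal_sqr_le.
- rewrite extremal_sqrB NE -sc !real_normK ?num_real //; ring.
- by rewrite PE; exact: extremal_dotp.
Qed.

(** Monotonicity of [acos] holds only on [[-1, 1]]; this keeps the extremal
    cosine in that domain. *)
Lemma extremal_cos_geN1 : -1 <= Q / T.
Proof.
have T0 := extremal_den_gt0.
have : `|Q| <= T.
  rewrite -(@ler_pXn2r _ 2) ?nnegrE ?(ltW T0) // real_normK ?num_real //.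
  exact: extremal_sqr_le.
by rewrite ler_norml ler_pdivlMr // mulN1r => /andP[].
Qed.

End ExtremalAngle.

(** * Eigenvectors *)

Lemma leigenspaceP (phi : 'End('rV[R]_2)) (l : R) x :
  reflect (phi x = l *: x) (x \in passmx.leigenspace phi l).
Proof.
rewrite memv_ker add_lfunE opp_lfunE scale_lfunE id_lfunE subr_eq0.
exact: eqP.
Qed.

Lemma eigenvectors_cross (phi : 'End('rV[R]_2)) (l1 l2 : R) u v : l1 != l2 ->
  phi u = l1 *: u -> phi v = l2 *: v -> u != 0 -> v != 0 -> cross u v != 0.
Proof.
move=> l12 eu ev u0 v0; apply/eqP => uv0.
(* A vector on both eigenlines vanishes; applied to the multiples of [u] by
   the coordinates of [v], this makes [v] vanish. *)
have common (c d : R) : c *: u = d *: v -> c = 0.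
  move=> cd; have := congr1 phi cd; rewrite !linearZ /= eu ev scalerA mulrC.
  rewrite -scalerA cd !scalerA [d * l2]mulrC => /eqP.
  rewrite -subr_eq0 -scalerBl -mulrBl scaler_eq0 (negPf v0) orbF mulf_eq0.
  rewrite subr_eq0 (negPf l12) /= => /eqP d0.
  by move/eqP: cd; rewrite d0 scale0r scaler_eq0 (negPf u0) orbF => /eqP.
move/eqP: v0; apply; apply: rV2_eqP; rewrite mxE.
- by apply: (common _ (u 0 0)); apply: rV2_eqP; rewrite !mxE; move: uv0;
    rewrite /cross; lra.
- by apply: (common _ (u 0 1)); apply: rV2_eqP; rewrite !mxE; move: uv0;
    rewrite /cross; lra.
Qed.

Lemma eigenbasis_decomp (phi : 'End('rV[R]_2)) (l1 l2 : R) u v x :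
  phi u = l1 *: u -> phi v = l2 *: v -> cross u v != 0 ->
  exists a b, x = a *: u + b *: v /\ phi x = (l1 * a) *: u + (l2 * b) *: v.
Proof.
move=> eu ev uv0.
have xE := cross_decomp x uv0; exists (cross x v / cross u v).
exists (cross u x / cross u v); split=> //.
rewrite [in LHS]xE linearD !linearZ /= eu ev !scalerA.
by congr (_ *: _ + _ *: _); rewrite mulrC.
Qed.

Lemma eigenbasis_neq0 (phi : 'End('rV[R]_2)) (l1 l2 : R) u v x :
  l1 != 0 -> l2 != 0 -> phi u = l1 *: u -> phi v = l2 *: v ->
  cross u v != 0 -> x != 0 -> phi x != 0.
Proof.
move=> l1_neq0 l2_neq0 eu ev uv0; apply: contraNneq => px0.
have [a [b [xE pxE]]] := eigenbasis_decomp x eu ev uv0.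
have la0 : l1 * a * cross u v = cross (phi x) v.
  by rewrite pxE /cross !mxE; ring.
have lb0 : l2 * b * cross u v = cross u (phi x).
  by rewrite pxE /cross !mxE; ring.
move/eqP: la0; move/eqP: lb0; rewrite px0 /cross !mxE !(mulr0, mul0r) subrr.
rewrite !mulf_eq0 (negPf uv0) (negPf l1_neq0) (negPf l2_neq0) !orbF /=.
by move=> /eqP b0 /eqP a0; rewrite xE a0 b0 !scale0r addr0.
Qed.

Lemma enorm_normalized x : x != 0 -> enorm ((enorm x)^-1 *: x) = 1.
Proof.
move=> x0; rewrite enormZ normfV ger0_norm ?enorm_ge0 //.
by rewrite mulVf // gt_eqF // enorm_gt0.
Qed.

Lemma eigen_vangle_cos (phi : 'End('rV[R]_2)) (l1 l2 : R) u v x :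
  0 < l1 -> l1 < l2 -> phi u = l1 *: u -> phi v = l2 *: v ->
  enorm u = 1 -> enorm v = 1 -> cross u v != 0 -> x != 0 -> phi x != 0 ->
  (2 * Num.sqrt (l1 * l2) - (l1 + l2) * `|dotp u v|)
    / (l1 + l2 - 2 * Num.sqrt (l1 * l2) * `|dotp u v|)
  <= dotp x (phi x) / (enorm x * enorm (phi x)).
Proof.
move=> l1_gt0 l12 eu ev nu nv uv0 x0 px0; set c := `|_|.
have uu : dotp u u = 1 by rewrite -sqr_enorm nu expr1n.
have vv : dotp v v = 1 by rewrite -sqr_enorm nv expr1n.
have uvE : cross u v ^+ 2 = 1 - dotp u v ^+ 2.
  by have := lagrange_identity u v; rewrite nu nv mulr1 expr1n; lra.
have c0 : 0 <= c by exact: normr_ge0.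
have c1 : c <= 1.
  rewrite -(@ler_pXn2r _ 2) ?nnegrE // expr1n real_normK ?num_real //.
  by have := sqr_ge0 (cross u v); rewrite uvE; lra.
have [a [b [xE pxE]]] := eigenbasis_decomp x eu ev uv0.
apply: (@extremal_cos l1 l2 c _ _ _ _ (dotp u v) a b) => //.
- by rewrite mulr_gt0 ?enorm_gt0.
- transitivity (l1 * a ^+ 2 * dotp u u + l2 * b ^+ 2 * dotp v v
    + (l1 + l2) * dotp u v * (a * b)); last by rewrite uu vv !mulr1.
  by rewrite pxE xE !dotpE !mxE; ring.
- rewrite lagrange_identity -uvE -exprMn; congr (_ + _ ^+ 2).
  by rewrite pxE xE /cross !mxE; ring.
Qed.

Lemma eigen_vangle (phi : 'End('rV[R]_2)) (l1 l2 c : R) u0 v0 x :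
  0 < l1 -> l1 < l2 -> phi u0 = l1 *: u0 -> phi v0 = l2 *: v0 ->
  u0 != 0 -> v0 != 0 -> x != 0 ->
  c = `|dotp u0 v0 / (enorm u0 * enorm v0)| ->
  0 <= vangle x (phi x) <=
    acos ((2 * Num.sqrt (l1 * l2) - (l1 + l2) * c)
          / (l1 + l2 - 2 * Num.sqrt (l1 * l2) * c)).
Proof.
move=> l1_gt0 l12 eu0 ev0 u0_neq0 v0_neq0 x0 cE.
pose u := (enorm u0)^-1 *: u0; pose v := (enorm v0)^-1 *: v0.
have nu : enorm u = 1 by rewrite enorm_normalized.
have nv : enorm v = 1 by rewrite enorm_normalized.
have u_neq0 : u != 0 by rewrite scaler_eq0 invr_eq0 gt_eqF ?enorm_gt0.
have v_neq0 : v != 0 by rewrite scaler_eq0 invr_eq0 gt_eqF ?enorm_gt0.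
have eu : phi u = l1 *: u by rewrite linearZ /= eu0 !scalerA mulrC.
have ev : phi v = l2 *: v by rewrite linearZ /= ev0 !scalerA mulrC.
have {}cE : c = `|dotp u v| by rewrite cE /u /v dotpZ -invfM mulrC.
have uv0 : cross u v != 0.
  by apply: eigenvectors_cross eu ev u_neq0 v_neq0; rewrite lt_eqF.
have px0 : phi x != 0.
  apply: (eigenbasis_neq0 _ _ eu ev uv0 x0); rewrite gt_eqF //.
  exact: lt_trans l12.
have /andP[k1 k2] := cos_vangle_bound x0 px0.
rewrite /vangle acos_ge0 ?k1 //=; apply: le_acos => //.
  rewrite cE; apply: extremal_cos_geN1 => //.
  have := cos_vangle_bound u_neq0 v_neq0.
  by rewrite nu nv mulr1 divr1 ler_norml.
by rewrite cE; exact: eigen_vangle_cos.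
Qed.

End Angles.

Theorem theorem1 (R : realType) (phi : 'End('rV[R]_2)) (lambda1 lambda2 : R)
    (h1 : passmx.leigenvalue phi lambda1) (h2 : passmx.leigenvalue phi lambda2)
    (h01 : 0 < lambda1) (h12 : lambda1 < lambda2)
    (beta : R)
    (hbeta : beta = line_angle (passmx.leigenspace phi lambda1)
                               (passmx.leigenspace phi lambda2))
    (x : 'rV[R]_2) (hx : x != 0) :
  0 <= vangle x (phi x) <=
    acos ((2 * Num.sqrt (lambda1 * lambda2) - (lambda1 + lambda2) * cos beta)
          / (lambda1 + lambda2 - 2 * Num.sqrt (lambda1 * lambda2) * cos beta)).
Proof.
have cE := cos_line_angle h1 h2; rewrite -hbeta in cE.
have u_eigen := leigenspaceP _ _ _ (memv_pick (passmx.leigenspace phi lambda1)).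
have v_eigen := leigenspaceP _ _ _ (memv_pick (passmx.leigenspace phi lambda2)).
have u_neq0 := vpick_neq0 h1; have v_neq0 := vpick_neq0 h2.
exact: eigen_vangle h01 h12 u_eigen v_eigen u_neq0 v_neq0 hx cE.
Qed.
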